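(* Let $\Gamma_D$ be the $N\times N$ diffusive outer coupling matrix defined in the context. If the network $$\dot x=(I_N\otimes A_1+\Gamma_D\otimes A_{12})x+(E_N\otimes B_1)w_1,\qquad y=(E_N^T\otimes C_1)x$$ is stable (i.e. $I_N\otimes A_1+\Gamma_D\otimes A_{12}$ is stable), then its $H_2$ norm is $\gamma_2N$, where $\gamma_2$ is the $H_2$ norm of the single-node system $\dot\xi=A_1\xi+B_1w_1,\ y_1=C_1\xi$.
   Context: $A_1\in\mathbf R^{n\times n}$, $B_1\in\mathbf R^{n\times m}$, $C_1\in\mathbf R^{m\times n}$ are constant matrices and $A_{12}=B_1C_1$. $\otimes$ is the Kronecker product, $I_N$ the identity matrix, $E_N=(1,\dots,1)^T\in\mathbf R^N$. A square matrix is stable if all its eigenvalues have negative real part. The $H_2$ norm of a system $\dot\xi=A\xi+Bw,\ y=C\xi$ with $A$ stable is that of its transfer function $G(s)=C(sI-A)^{-1}B$, namely $\|G\|_2=\sqrt{\frac1{2\pi}\int_{-\infty}^{\infty}\mathrm{trace}\{G(j\omega)^HG(j\omega)\}\,d\omega}$. $\Gamma_D=(\gamma_{ij})_{N\times N}$ is defined as follows: for $i\ne j$, $\gamma_{ij}=-1$ if $j\le i-2$ and $j$ is odd, and $\gamma_{ij}=1$ otherwise; the diagonal entries are $\gamma_{ii}=-\sum_{j\ne i}\gamma_{ij}$. *)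

(* Defs.v *)
From mathcomp Require Import all_boot all_order all_algebra.
From mathcomp Require Import all_classical all_reals all_analysis.
From mathcomp.real_closed Require Import complex mxtens.

Set Implicit Arguments.
Unset Strict Implicit.
Unset Printing Implicit Defensive.

Import Order.TTheory GRing.Theory Num.Theory.
Import numFieldNormedType.Exports.

Local Open Scope complex_scope.
Local Open Scope ring_scope.

(* The eigenvalues of a real matrix are taken over R[i]. *)
Definition stable (R : realType) (n : nat) (A : 'M[R]_n) : Prop :=
  forall a : R[i], eigenvalue (map_mx (real_complex R) A) a -> complex.Re a < 0.

(* invmx returns its argument on singular matrices, so this is the transfer
   function only where s is not an eigenvalue of A; when A is stable this
   covers the whole imaginary axis. *)
Definition transfer (R : realType) (n p q : nat)
    (A : 'M[R]_n) (B : 'M[R]_(n, p)) (C : 'M[R]_(q, n)) (s : R[i]) :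
    'M[R[i]]_(q, p) :=
  map_mx (real_complex R) C
    *m invmx (s%:M - map_mx (real_complex R) A)
    *m map_mx (real_complex R) B.

(* The trace of G^H G is a nonnegative real stored in R[i], hence the use of
   Re. The norm is extended-real valued: it is +oo when the integral
   diverges. *)
Definition H2norm_tf (R : realType) (p q : nat) (G : R[i] -> 'M[R[i]]_(q, p)) :
    \bar R :=
  sqrte ((2 * pi)^-1%:E *
    \int[@lebesgue_measure R]_w
      (complex.Re (\tr ((map_mx (@conjc R) (G (0 +i* w)))^T
                        *m G (0 +i* w))))%:E)%E.

Definition H2norm (R : realType) (n p q : nat)
    (A : 'M[R]_n) (B : 'M[R]_(n, p)) (C : 'M[R]_(q, n)) : \bar R :=
  H2norm_tf (transfer A B C).

(* Off-diagonal entry, in the customary numbering of rows and columns from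
   1. *)
Definition gammaD_off (R : realType) (i j : nat) : R :=
  if (j + 2 <= i)%N && odd j then -1 else 1.

(* Ordinals start at 0, hence the shifts by one. *)
Definition GammaD (R : realType) (N : nat) : 'M[R]_N :=
  \matrix_(i < N, j < N)
    if i == j then - \sum_(k < N | k != i) gammaD_off R i.+1 k.+1
    else gammaD_off R i.+1 j.+1.

(* Main.v *)
Require Import Defs.
From mathcomp Require Import all_boot all_order all_algebra.
From mathcomp Require Import all_classical all_reals all_analysis.
From mathcomp.real_closed Require Import complex mxtens.

Import Order.TTheory GRing.Theory Num.Theory.

Local Open Scope ring_scope.

(** The rows of [GammaD] sum to zero, so [E_N (x) x] is mapped by
    [I_N (x) A_1 + GammaD (x) A_12] to [E_N (x) A_1 x]. Hence the resolvent of
    the network matrix sends [E_N (x) B_1] to [E_N (x) (s - A_1)^-1 B_1], and as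
    [E_N^T E_N = N] the transfer function of the network is [N] times that of
    a single node. *)

Lemma mxtrace_tens (R : pzRingType) (m n : nat) (A : 'M[R]_m) (B : 'M[R]_n) :
  \tr (A *t B) = \tr A * \tr B.
Proof. by rewrite /mxtrace mulr_sum; apply: eq_bigr => i _; rewrite mxE. Qed.

Lemma const1_trmx_mul (R : pzRingType) (N : nat) :
  (const_mx 1 : 'cV[R]_N)^T *m (const_mx 1 : 'cV[R]_N) = (N%:R)%:M.
Proof.
apply/matrixP => i j; rewrite !mxE !ord1 eqxx.
under eq_bigr do rewrite !mxE mulr1.
by rewrite sumr_const card_ord.
Qed.

(** Every block of the product is a copy of [X], and [0 < N] provides a first block to read it
    from. *)
Lemma tens_const1_eq0 (R : pzRingType) (N p q : nat) (X : 'M[R]_(p, q)) :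
  (0 < N)%N -> (const_mx 1 : 'cV[R]_N) *t X = 0 -> X = 0.
Proof.
case: N => // N _ /matrixP tX0; apply/matrixP => i j.
by have := tX0 (mxtens_index (ord0, i)) (mxtens_index (ord0, j));
  rewrite tensmxE !mxE mul1r.
Qed.

Section Network.
Variables (F : fieldType) (n N : nat) (A1 A12 : 'M[F]_n) (Gamma : 'M[F]_N).
Variable N_gt0 : (0 < N)%N.
Let EN : 'cV[F]_N := const_mx 1.
Hypothesis Gamma_diffusive : Gamma *m EN = 0.
Let A : 'M[F]_(N * n) := (1%:M : 'M[F]_N) *t A1 + Gamma *t A12.

Lemma network_mul_const (s : F) (q : nat) (X : 'M[F]_(n, q)) :
  (s%:M - A) *m (EN *t X) = EN *t ((s%:M - A1) *m X).
Proof.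
rewrite /A !mulmxBl mulmxDl !tensmx_mul Gamma_diffusive tens0mx addr0 mul1mx.
rewrite !mul_scalar_mx; apply/matrixP => i j.
by rewrite !mxE mulrBr mulrCA.
Qed.

(** A kernel vector [x] of [s - A1] would give the kernel vector [EN *t x] of [s - A]. Thus
    invertibility for the single node is inherited from the network. *)
Lemma network_resolvent_unit (s : F) :
  s%:M - A \in unitmx -> s%:M - A1 \in unitmx.
Proof.
(* [det0P] yields a row vector killed from the left, so it is applied to the transpose to obtain a
   right kernel vector [v^T]. *)
move=> uA; rewrite -unitmx_tr unitmxE unitfE; apply/negP => /det0P[v v0 vA].
suff /trmx_inj v00 : v^T = 0^T by rewrite v00 eqxx in v0.
rewrite trmx0; apply: (@tens_const1_eq0 F N) => //.
rewrite -/EN -[LHS](mulKmx uA) network_mul_const -[_ *m v^T]trmxK.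
by rewrite trmx_mul trmxK vA trmx0 tensmx0 mulmx0.
Qed.

Lemma network_transfer (s : F) (p q : nat) (B : 'M[F]_(n, p))
    (C : 'M[F]_(q, n)) : s%:M - A \in unitmx ->
  (EN^T *t C) *m invmx (s%:M - A) *m (EN *t B) =
  (N%:R)%:M *t (C *m invmx (s%:M - A1) *m B).
Proof.
move=> uA; have uA1 := network_resolvent_unit _ uA.
have -> : EN *t B = (s%:M - A) *m (EN *t (invmx (s%:M - A1) *m B)).
  by rewrite network_mul_const mulKVmx.
by rewrite -mulmxA mulKmx // tensmx_mul const1_trmx_mul mulmxA.
Qed.

End Network.

(** Otherwise [iw] would be an eigenvalue of [A] with real part 0. *)
Lemma stable_resolvent_unit {R : realType} {n : nat} {A : 'M[R]_n} (w : R) :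
  stable A -> ((Complex 0 w)%:M - map_mx (real_complex R) A) \in unitmx.
Proof.
move=> sA; rewrite unitmxE unitfE; apply/negP => /det0P[v v0 vA].
have /sA : eigenvalue (map_mx (real_complex R) A) (Complex 0 w).
  apply/eigenvalueP; exists v => //; apply/esym/eqP.
  by rewrite -subr_eq0 -mul_mx_scalar -mulmxBr vA.
by rewrite ltxx.
Qed.

Lemma GammaD_const1 (R : realType) (N : nat) :
  GammaD R N *m (const_mx 1 : 'cV[R]_N) = 0.
Proof.
apply/matrixP => i j; rewrite !mxE (bigD1 i) //= !mxE eqxx mulr1.
apply/eqP; rewrite addrC addr_eq0 opprK; apply/eqP.
by apply: eq_bigr => k ki; rewrite !mxE eq_sym (negbTE ki) mulr1.
Qed.

Section IntegralScale.
Context d (T : measurableType d) (R : realType).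
Variable mu : {measure set T -> \bar R}.
Import HBNNSimple.
Local Open Scope ereal_scope.

(* [ge0_integralZl] asks for [f] to be measurable; for a positive finite factor
   scaling the simple functions below [f] does without. *)
Let integral_scale_le (c : R) (f : T -> \bar R) :
  (0 < c)%R -> (forall x, 0 <= f x) ->
  c%:E * \int[mu]_x f x <= \int[mu]_x (c%:E * f x).
Proof.
move=> c0 f0.
have cf0 x : 0 <= c%:E * f x by rewrite mule_ge0// lee_fin ltW.
rewrite (ge0_integralTE _ f0) (ge0_integralTE _ cf0) -lee_pdivlMl//.
apply: ge_ereal_sup => _ [h /= hf <-]; rewrite lee_pdivlMl// -sintegralrM.
apply: ereal_sup_ubound; exists (scale_nnsfun h (ltW c0)) => //= x.
by rewrite EFinM lee_wpmul2l // lee_fin ltW.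
Qed.

Lemma ge0_integral_scale (c : R) (f : T -> \bar R) :
  (0 < c)%R -> (forall x, 0 <= f x) ->
  \int[mu]_x (c%:E * f x) = c%:E * \int[mu]_x f x.
Proof.
move=> c0 f0; apply/eqP; rewrite eq_le integral_scale_le // andbT.
have cf0 x : 0 <= c%:E * f x by rewrite mule_ge0// lee_fin ltW.
have ci0 : (0 < c^-1)%R by rewrite invr_gt0.
(* The reverse inequality is the first one for the factor [c^-1] and the function [c * f]. *)
rewrite -lee_pdivrMl//; apply: le_trans (integral_scale_le _ _ ci0 cf0) _.
under eq_integral do rewrite muleA -EFinM mulVf ?gt_eqF // mul1e.
by [].
Qed.

End IntegralScale.

Lemma mxtrace_gram_ge0 (R : realType) (p q : nat) (G : 'M[R[i]]_(q, p)) :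
  0 <= complex.Re (\tr ((map_mx (@conjc R) G)^T *m G)).
Proof.
(* Nonnegativity in [R[i]] means a zero imaginary part and a nonnegative real part. The trace is the
   sum of the squared moduli of the entries. *)
suff : 0 <= \tr ((map_mx (@conjc R) G)^T *m G) by rewrite lecE => /andP[].
apply: sumr_ge0 => i _; rewrite mxE; apply: sumr_ge0 => j _.
by rewrite !mxE mulrC -sqr_normc exprn_ge0.
Qed.

(** The integrand picks up the factor [N^2], whose square root is [N]; this includes the case of an
    infinite integral. The norm only sees [G] on the imaginary axis. *)
Lemma H2norm_tf_scale (R : realType) (m N : nat)
    (G : R[i] -> 'M[R[i]]_(1 * m)) (G1 : R[i] -> 'M[R[i]]_m) :
  (0 < N)%N ->
  (forall w : R, G (Complex 0 w) = (N%:R)%:M *t G1 (Complex 0 w)) ->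
  H2norm_tf G = (H2norm_tf G1 * N%:R%:E)%E.
Proof.
move=> N_gt0 GE; rewrite /H2norm_tf.
have N2 : 0 < (N%:R ^+ 2 : R) by rewrite exprn_gt0 // ltr0n.
have tr_G w : complex.Re (\tr ((map_mx (@conjc R) (G (Complex 0 w)))^T
                        *m G (Complex 0 w))) =
    N%:R ^+ 2 * complex.Re (\tr ((map_mx (@conjc R) (G1 (Complex 0 w)))^T
                        *m G1 (Complex 0 w))).
  (* The Gram matrix is the 1 by 1 matrix [N^2] tensored with that of [G1], and the trace is
     multiplicative. *)
  rewrite GE map_mxT trmx_tens tensmx_mul mxtrace_tens map_scalar_mx.
  rewrite tr_scalar_mx -scalar_mxM mxtrace_scalar mulr1n /= rmorph_nat.
  by rewrite -natrM expr2 -natrM !mulr_natl raddfMn.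
under eq_integral do rewrite tr_G EFinM.
rewrite ge0_integral_scale //; last first.
  by move=> w; rewrite lee_fin mxtrace_gram_ge0.
rewrite muleCA muleC sqrteM; last first.
  rewrite mule_ge0 // ?lee_fin ?invr_ge0 ?mulr_ge0 ?pi_ge0 //.
  by apply: integral_ge0 => w _; rewrite lee_fin mxtrace_gram_ge0.
by congr (_ * _)%E; rewrite /= sqrtr_sqr normr_nat.
Qed.

Theorem theorem2 (R : realType) (n m N : nat)
    (A1 : 'M[R]_n) (B1 : 'M[R]_(n, m)) (C1 : 'M[R]_(m, n))
    (N_gt0 : (0 < N)%N) :
  let A12 : 'M[R]_n := B1 *m C1 in
  let EN : 'cV[R]_N := const_mx 1 in
  let A : 'M[R]_(N * n) :=
    (1%:M : 'M[R]_N) *t A1 + GammaD R N *t A12 in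
  let B : 'M[R]_(N * n, 1 * m) := EN *t B1 in
  let C : 'M[R]_(1 * m, N * n) := EN^T *t C1 in
  stable A ->
  H2norm A B C = (H2norm A1 B1 C1 * N%:R%:E)%E.
Proof.
move=> A12 EN A B C stA; apply: H2norm_tf_scale => // w.
have := stable_resolvent_unit w stA.
rewrite /transfer /A /B /C map_mxD !map_mxT -[map_mx _ EN^T]matrix.map_trmx.
rewrite map_mx1 map_const_mx rmorph1 /= => uA; apply: network_transfer => //.
(* The zero row sums are known over [R]; they are carried to [R[i]] along the embedding. *)
rewrite -[const_mx 1](map_const_mx (real_complex R)) -map_mxM.
by rewrite GammaD_const1 map_mx0.
Qed.
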